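(* Given a set $P$ of $n$ colored points and an ordered color set $C$, a backbone labeling with one label per color, labels in the given order, finite backbones, and the minimum number of crossings can be computed in $O(n|C|)$ time.
   Context: Setting: $P$ is a finite set of points in an axis-aligned rectangle $R$; each $p\in P$ has a color $c(p)\in C$, where $C=\{1,\dots,|C|\}$ is ordered; no two points share the same $x$- or the same $y$-coordinate, and the points are given in decreasing order of $y$-coordinate. A backbone labeling with one label per color assigns to each color $i\in C$ a single label on the right side of $R$, described by the $y$-coordinate of its backbone; all points of color $i$ are connected to this label. The backbone leader of color $i$ consists of a horizontal segment at that height (the backbone) together with, for each point of color $i$, the vertical segment joining the point to the backbone. A finite backbone extends horizontally from the label on the right side of $R$ to the $x$-coordinate of the leftmost point connected to it. Leaders of distinct labels may cross but not overlap. Labels are in the given order if for all colors $i<j$ the label (and backbone) of color $i$ is above that of color $j$. The positions of the backbones are otherwise free. The number of crossings is the number of pairs consisting of a backbone and a vertical segment belonging to a different label that cross each other; the minimum is taken over all labelings satisfying these requirements. *)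

(* Defs.v *)
From mathcomp Require Import all_boot all_order all_algebra.

Set Implicit Arguments.
Unset Strict Implicit.
Unset Printing Implicit Defensive.
Import Order.TTheory GRing.Theory Num.Theory.
Local Open Scope ring_scope.

(** * Backbone labelings *)

(* The ordered field F is the field of coordinates; the real plane is the
   instance where F is the field of real numbers.  The points are indexed from
   top to bottom and the colors 1, ..., |C| are represented by 0, ..., |C|-1. *)
Record instance (F : realFieldType) := Instance {
  npts : nat;
  ncol : nat;
  xleft : F; xright : F; ybot : F; ytop : F;
  px : 'I_npts -> F;
  py : 'I_npts -> F;
  color : 'I_npts -> 'I_ncol;
  rect_width : xleft < xright;
  rect_height : ybot < ytop;
  px_in_rect : forall p, xleft <= px p <= xright;
  py_in_rect : forall p, ybot <= py p <= ytop;
  px_inj : injective px;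
  py_decr : forall p q : 'I_npts, (p < q)%N -> py q < py p
}.

Section Labelings.
Variables (F : realFieldType) (I : instance F).
Local Notation pt := 'I_(npts I).
Local Notation col := 'I_(ncol I).

(* [b i] is the height of the backbone (and of the label) of color [i]. *)
Implicit Type b : col -> F.

Definition leftmost (i : col) (p : pt) : bool :=
  (color p == i) && [forall q, (color q == i) ==> (px p <= px q)].

(* The finite backbone of a color that has no point is empty. *)
Definition backbone b (i : col) : pred (F * F) :=
  [pred z | (z.2 == b i) &&
            [exists p, leftmost i p && (px p <= z.1 <= xright I)]].

Definition vsegment b (p : pt) : pred (F * F) :=
  [pred z | (z.1 == px p) &&
            (Num.min (py p) (b (color p)) <= z.2
               <= Num.max (py p) (b (color p)))].

Definition leader_segment b (i : col) (s : pred (F * F)) : Prop :=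
  s = backbone b i \/ exists2 p, color p = i & s = vsegment b p.

(* Two segments that share two points share the whole segment between them. *)
Definition overlap b (i j : col) : Prop :=
  exists s t : pred (F * F), exists z z' : F * F,
    [/\ leader_segment b i s, leader_segment b j t, z != z',
        (z \in s) && (z' \in s) & (z \in t) && (z' \in t)].

Record labeling b : Prop := Labeling {
  label_on_right_side : forall i, ybot I <= b i <= ytop I;
  label_order : forall i j : col, (i < j)%N -> b j < b i;
  no_overlap : forall i j, i != j -> ~ overlap b i j
}.

(* [(px p, b i)] is the only point that a segment at height [b i] and a segment
   at abscissa [px p] can have in common. *)
Definition crosses b (i : col) (p : pt) : bool :=
  [&& color p != i, (px p, b i) \in backbone b i
    & (px p, b i) \in vsegment b p].

Definition crossings b : nat :=
  #|[set ip : col * pt | crosses b ip.1 ip.2]|.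

Definition min_crossing_labeling b : Prop :=
  labeling b /\ forall b', labeling b' -> (crossings b <= crossings b')%N.

End Labelings.

(** * A real random access machine, with unit cost *)

(* The store consists of arrays of natural numbers and arrays of elements of F;
   [nats m a k] is the entry of index [k] of array [a].  A program refers to
   finitely many arrays. *)
Record store (F : Type) := Store {
  nats : nat -> nat -> nat;
  reals : nat -> nat -> F
}.

(* Cells: [Var a] is entry 0 of array [a], and [Elt a v] is the entry of [a]
   whose index is the current value of the natural number variable [v]. *)
Inductive cell := Var (a : nat) | Elt (a v : nat).

Inductive instr :=
| NConst (d : cell) (k : nat)
| NCopy (d s : cell)
| NAdd (d s t : cell)
| NSub (d s t : cell)
| RConst (d : cell) (k : nat)
| RCopy (d s : cell)
| RAdd (d s t : cell)
| RSub (d s t : cell)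
| RMul (d s t : cell)
| RDiv (d s t : cell).

Inductive test :=
| NLt (s t : cell)
| RLt (s t : cell).

Inductive prog :=
| Skip
| Do (i : instr)
| Seq (A B : prog)
| If (c : test) (A B : prog)
| While (c : test) (A : prog).

Definition update (T : Type) (f : nat -> nat -> T) (l : nat * nat) (v : T) :=
  fun a k => if (a == l.1) && (k == l.2) then v else f a k.

Section Semantics.
Variable F : realFieldType.
Implicit Type m : store F.

Definition addr m (l : cell) : nat * nat :=
  match l with
  | Var a => (a, 0%N)
  | Elt a v => (a, nats m v 0%N)
  end.

Definition nget m (l : cell) : nat := nats m (addr m l).1 (addr m l).2.
Definition rget m (l : cell) : F := reals m (addr m l).1 (addr m l).2.
Definition nset m (l : cell) (v : nat) : store F :=
  Store (update (nats m) (addr m l) v) (reals m).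
Definition rset m (l : cell) (v : F) : store F :=
  Store (nats m) (update (reals m) (addr m l) v).

Definition run_instr (i : instr) m : store F :=
  match i with
  | NConst d k => nset m d k
  | NCopy d s => nset m d (nget m s)
  | NAdd d s t => nset m d (nget m s + nget m t)%N
  | NSub d s t => nset m d (nget m s - nget m t)%N
  | RConst d k => rset m d k%:R
  | RCopy d s => rset m d (rget m s)
  | RAdd d s t => rset m d (rget m s + rget m t)
  | RSub d s t => rset m d (rget m s - rget m t)
  | RMul d s t => rset m d (rget m s * rget m t)
  | RDiv d s t => rset m d (rget m s / rget m t)
  end.

Definition run_test (c : test) m : bool :=
  match c with
  | NLt s t => (nget m s < nget m t)%N
  | RLt s t => rget m s < rget m t
  end.

(* [exec A m m' T]: started in store [m], the program [A] halts in store [m']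
   after [T] steps, a step being an instruction or the evaluation of a test. *)
Inductive exec : prog -> store F -> store F -> nat -> Prop :=
| ExecSkip m : exec Skip m m 0
| ExecDo i m : exec (Do i) m (run_instr i m) 1
| ExecSeq A B m m' m'' T T' :
    exec A m m' T -> exec B m' m'' T' -> exec (Seq A B) m m'' (T + T')
| ExecIfTrue c A B m m' T :
    run_test c m -> exec A m m' T -> exec (If c A B) m m' T.+1
| ExecIfFalse c A B m m' T :
    ~~ run_test c m -> exec B m m' T -> exec (If c A B) m m' T.+1
| ExecWhileTrue c A m m' m'' T T' :
    run_test c m -> exec A m m' T -> exec (While c A) m' m'' T' ->
    exec (While c A) m m'' (T + T').+1
| ExecWhileFalse c A m :
    ~~ run_test c m -> exec (While c A) m m 1.

(* The value of [f] at [k] when [k < n], and [d] otherwise. *)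
Definition ext (T : Type) (n : nat) (d : T) (f : 'I_n -> T) (k : nat) : T :=
  if insub k is Some i then f i else d.

(* Arrays of natural numbers: n, |C|, the colors of the points.  Arrays of
   coordinates: the rectangle, the abscissas, the ordinates.  All other entries
   are 0. *)
Definition input (I : instance F) : store F :=
  Store
    (fun a k => match a with
                | 0 => if k == 0 then npts I else 0
                | 1 => if k == 0 then ncol I else 0
                | 2 => ext 0 (fun p : 'I_(npts I) => color p : nat) k
                | _ => 0
                end%N)
    (fun a k => match a with
                | 0%N => nth 0 [:: xleft I; xright I; ybot I; ytop I] k
                | 1%N => ext 0 (@px F I) k
                | 2%N => ext 0 (@py F I) k
                | _ => 0
                end).

(* The heights of the backbones are returned in array 3 of coordinates. *)
Definition output (I : instance F) (m : store F) : 'I_(ncol I) -> F :=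
  fun i => reals m 3 i.

End Semantics.

Arguments output {F} I m _.

(* Main.v *)
(* A backbone of color i at height y crosses the vertical segment of a point p
   to the right of its left end iff either c(p) < i and p is not above y, or
   c(p) > i and p is not below y, whatever the heights of the other backbones.
   So the number of crossings is a sum of costs f_i(g_i), where g_i is the gap
   between consecutive points that contains the backbone of color i, and the
   given order only requires the gaps to be nonincreasing in height.  Backbones
   at the height of a point never do better than those in an adjacent gap, and
   any number of backbones fits into a gap of positive length.  A dynamic program
   over the colors, with one row of n + 1 gaps for each, minimizes the sum; the
   values f_i(g) are updated in constant time from one gap to the next.  Gaps of
   length zero, which occur when the first or last point lies on the boundary of
   R, get the cost n|C| + 1, which exceeds the number of crossings of every
   labeling. *)
Require Import Defs.
From mathcomp Require Import all_boot all_order all_algebra.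
From mathcomp Require Import zify lra.

Set Implicit Arguments.
Unset Strict Implicit.
Unset Printing Implicit Defensive.
Import Order.TTheory GRing.Theory Num.Theory.
Local Open Scope ring_scope.

(** * Running programs *)

Section Runs.
Variable F : realFieldType.
Implicit Types (m : store F) (A B : prog) (Q : store F -> Prop).
Local Open Scope nat_scope.

(** [T] is only an upper bound on the number of steps, so that branches of different lengths share
    one bound. *)
Definition runs A m T Q :=
  exists m' T', [/\ exec A m m' T', T' <= T & Q m'].

Lemma runs_seq A B m T T' Q :
  runs A m T (fun m' => runs B m' T' Q) -> runs (Seq A B) m (T + T') Q.
Proof.
move=> [m' [t [eA let_T [m'' [t' [eB let_T' Qm]]]]]].
by exists m'', (t + t'); split=> //; [apply: ExecSeq eA eB | apply: leq_add].
Qed.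

Lemma runs_imp A m T T' Q Q' :
    T <= T' -> (forall m', Q m' -> Q' m') ->
  runs A m T Q -> runs A m T' Q'.
Proof.
move=> leTT' QQ' [m' [t [eA let_T Qm]]].
by exists m', t; split=> //; [apply: leq_trans leTT' | apply: QQ'].
Qed.

(** The invariant [J] is indexed by the number of finished iterations. Each iteration pays for its
    body and one test, and the last [.+1] is the failing test. *)
Lemma runs_while c A m N T (J : nat -> store F -> Prop) Q :
    (forall j m', j < N -> J j m' -> run_test c m' /\ runs A m' T (J j.+1)) ->
    (forall m', J N m' -> ~~ run_test c m' /\ Q m') -> J 0 m ->
  runs (While c A) m (N * T.+1).+1 Q.
Proof.
move=> stepJ endJ J0.
suff loop d j m' : N = d + j -> J j m' ->
    runs (While c A) m' (d * T.+1).+1 Q.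
  exact: (loop N 0 m (esym (addn0 N)) J0).
elim: d j m' => [|d IHd] j m' defN Jj.
  have [|cf Qm] := endJ m'; first by rewrite defN.
  by exists m', 1; split=> //; apply: ExecWhileFalse.
have [|ctrue [m1 [t [eA let_T Jj1]]]] := stepJ j m' _ Jj; first lia.
have [|m2 [t' [eW let_T' Qm]]] := IHd j.+1 m1 _ Jj1; first lia.
exists m2, (t + t').+1; split=> //; first exact: ExecWhileTrue eW.
by rewrite mulSn; lia.
Qed.

(* Weakest precondition, [False] on loops, for which there is [runs_while]. *)
Fixpoint wp A Q m : Prop :=
  match A with
  | Skip => Q m
  | Do i => Q (run_instr i m)
  | Seq A B => wp A (wp B Q) m
  | If c A B => if run_test c m then wp A Q m else wp B Q m
  | While _ _ => False
  end.

(** The value on a loop is a dummy: [wp] is [False] there. *)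
Fixpoint steps A :=
  match A with
  | Do _ => 1
  | Seq A B => steps A + steps B
  | If _ A B => (maxn (steps A) (steps B)).+1
  | _ => 0
  end.

Lemma runs_wp A m Q : wp A Q m -> runs A m (steps A) Q.
Proof.
elim: A m Q => //= [|i|A IHA B IHB|c A IHA B IHB] m Q.
- by exists m, 0; split=> //; constructor.
- by exists (run_instr i m), 1; split=> //; constructor.
- move=> /IHA[m' [t [eA let_A /IHB wpB]]].
  by apply: runs_seq; exists m', t.
case: ifP => [ct /IHA | /negbT cf /IHB] [m' [t [e let_ Qm]]].
  by exists m', t.+1; split=> //; [apply: ExecIfTrue | lia].
by exists m', t.+1; split=> //; [apply: ExecIfFalse | lia].
Qed.

(* Evaluating one entry at a time keeps terms small: unfolding [run_instr]
   would copy the whole store at each read. *)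
Definition nval m c :=
  match c with Var a => nats m a 0 | Elt a v => nats m a (nats m v 0) end.

Definition rval m c :=
  match c with Var a => reals m a 0 | Elt a v => reals m a (nats m v 0) end.

(** Array names are compared with [eqn], which computes on the numerals of a program, while indices
    read from the store stay symbolic under [==]. *)
Definition entry_of m c a k : bool :=
  match c with
  | Var a' => eqn a a' && eqn k 0
  | Elt a' v => eqn a a' && (k == nats m v 0)
  end.

Definition nwrite m d v a k := if entry_of m d a k then v else nats m a k.

Definition rwrite m d v a k := if entry_of m d a k then v else reals m a k.

Lemma nats_run i m a k :
  nats (run_instr i m) a k =
  match i with
  | NConst d v => nwrite m d v a k
  | NCopy d s => nwrite m d (nval m s) a k
  | NAdd d s t => nwrite m d (nval m s + nval m t) a k
  | NSub d s t => nwrite m d (nval m s - nval m t) a k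
  | _ => nats m a k
  end.
Proof.
by case: i => *; repeat match goal with c : cell |- _ => destruct c end.
Qed.

Lemma reals_run i m a k :
  reals (run_instr i m) a k =
  (match i with
   | RConst d v => rwrite m d v%:R a k
   | RCopy d s => rwrite m d (rval m s) a k
   | RAdd d s t => rwrite m d (rval m s + rval m t) a k
   | RSub d s t => rwrite m d (rval m s - rval m t) a k
   | RMul d s t => rwrite m d (rval m s * rval m t) a k
   | RDiv d s t => rwrite m d (rval m s / rval m t) a k
   | _ => reals m a k
   end)%R.
Proof.
by case: i => *; repeat match goal with c : cell |- _ => destruct c end.
Qed.

Lemma run_testE c m :
  run_test c m =
  match c with
  | NLt s t => nval m s < nval m t
  | RLt s t => (rval m s < rval m t)%R
  end.
Proof. by case: c => [] [? | ? ?] []. Qed.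

End Runs.

Ltac eval_store :=
  repeat (rewrite ?run_testE ?nats_run ?reals_run;
          lazy beta iota delta [nwrite rwrite nval rval entry_of eqn andb negb]).

Ltac wp_step :=
  lazymatch goal with
  | |- wp Skip ?Q ?m => change (Q m)
  | |- wp (Do ?i) ?Q ?m => change (Q (run_instr i m))
  | |- wp (Seq ?A ?B) ?Q ?m => change (wp A (wp B Q) m)
  | |- wp (If ?c ?A ?B) ?Q ?m =>
    change (if run_test c m then wp A Q m else wp B Q m)
  end.

(** * The dynamic program *)

Section Scan.
Local Open Scope nat_scope.

(* Running minimum, capped by [init], and the first place where it is attained
   ([0] if it is [init]). *)
Fixpoint scan (w : nat -> nat) (init g : nat) : nat * nat :=
  if g is g'.+1 then
    let r := scan w init g' in if w g' < r.1 then (w g', g') else r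
  else (init, 0).

(** If [w 0 = init], the strict test fails at [0], but the default place [0] is then still
    correct. *)
Lemma scanP w init g : w 0 <= init ->
  let r := scan w init g.+1 in
  [/\ r.2 <= g, r.1 = w r.2 & forall h, h <= g -> r.1 <= w h].
Proof.
move=> w0_le; elim: g => [|g IHg].
  by rewrite /=; case: ltnP => /= w0; split; try lia;
     move=> h; rewrite leqn0 => /eqP->.
move: IHg; rewrite [scan _ _ g.+2]/= -/(scan w init g.+1).
case: (scan w init g.+1) => v a /= [a_le def_v v_le].
case: ltnP => /= wg; split=> //; try lia; move=> h; rewrite leq_eqVlt.
  by case/orP=> [/eqP-> // | /v_le]; lia.
by case/orP=> [/eqP-> // | /v_le].
Qed.

Variables (big : nat) (e : nat -> nat -> nat).

(** The cap [W 0 + big] plays the role of infinity: it is at least the first entry when the costs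
    are bounded by [big]. *)
Definition scan_row (W : nat -> nat) i :=
  scan (fun g => W g + e i g) (W 0 + big).

(* [best i g] is the least cost of the first [i] colors when they use gaps up
   to [g]. *)
Fixpoint best i : nat -> nat :=
  if i is i'.+1 then fun g => (scan_row (best i') i' g.+1).1 else fun=> 0.

Definition choice i g := (scan_row (best i) i g.+1).2.

(** Backtracking: the gap chosen for the last color becomes the bound for the colors before it. *)
Fixpoint trace i g : nat -> nat :=
  if i is i'.+1 then
    fun j => if j == i' then choice i' g else trace i' (choice i' g) j
  else fun=> 0.

Hypothesis e_le : forall i g, e i g <= big.

Lemma best_choice i g :
  [/\ choice i g <= g,
      best i.+1 g = best i (choice i g) + e i (choice i g)
    & forall h, h <= g -> best i.+1 g <= best i h + e i h].
Proof. by apply: scanP; rewrite leq_add2l. Qed.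

Lemma best_trace i g : best i g = \sum_(j < i) e j (trace i g j).
Proof.
elim: i g => [|i IHi] g; first by rewrite big_ord0.
have [_ -> _] := best_choice i g.
rewrite big_ord_recr /= eqxx IHi; congr (_ + _).
by apply: eq_bigr => j _; rewrite ltn_eqF.
Qed.

Lemma trace_le i g j : j < i -> trace i g j <= g.
Proof.
elim: i g => // i IHi g; have [c_le _ _] := best_choice i g.
rewrite ltnS leq_eqVlt /=; case: eqP => //= _ lt_ji.
exact: leq_trans (IHi _ lt_ji) c_le.
Qed.

Lemma trace_mono i g j j' : j <= j' -> j' < i -> trace i g j <= trace i g j'.
Proof.
elim: i g => // i IHi g le_jj'.
rewrite ltnS leq_eqVlt /= => /orP[/eqP def_j' | lt_j'i].
  by rewrite def_j' eqxx; case: eqP => // ne_ji; apply: trace_le; lia.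
by rewrite !ltn_eqF ?IHi ?(leq_ltn_trans le_jj').
Qed.

(** Monotonicity bounds the gaps of the earlier colors by [h i], so the induction hypothesis applies
    with [h i] in place of [g]. *)
Lemma best_opt i g (h : nat -> nat) :
    (forall j j', j <= j' -> j' < i -> h j <= h j') ->
    (forall j, j < i -> h j <= g) ->
  best i g <= \sum_(j < i) e j (h j).
Proof.
elim: i g => [|i IHi] g h_mono h_le //.
have [_ _ /(_ (h i) (h_le i (ltnSn i))) le_best] := best_choice i g.
apply: leq_trans le_best _; rewrite big_ord_recr leq_add2r /=.
apply: IHi => [j j' le_jj' lt_j'i | j lt_ji]; apply: h_mono; lia.
Qed.

End Scan.

(** * The program *)

(* [a...] are arrays of natural numbers and [r...] arrays of coordinates.  For
   the color in [aI], [aVal] and [aArg] are a running minimum and the gap where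
   it is attained; [aChoice] is a table with n + 1 columns stored row by row,
   and [aBase] is the index where the row of the current color starts. *)
Local Notation aN := 0%N (only parsing).
Local Notation aK := 1%N (only parsing).
Local Notation aCol := 2%N (only parsing).
Local Notation aOne := 3%N (only parsing).
Local Notation aI := 4%N (only parsing).
Local Notation aP := 5%N (only parsing).
Local Notation aBase := 6%N (only parsing).
Local Notation aIdx := 7%N (only parsing).
Local Notation aCost := 8%N (only parsing).
Local Notation aVal := 9%N (only parsing).
Local Notation aArg := 10%N (only parsing).
Local Notation aBest := 11%N (only parsing).
Local Notation aChoice := 12%N (only parsing).
Local Notation aBig := 13%N (only parsing).
Local Notation aG := 14%N (only parsing).
Local Notation aN1 := 15%N (only parsing).
Local Notation aTmp := 16%N (only parsing).
Local Notation aZero := 17%N (only parsing).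
Local Notation aG1 := 18%N (only parsing).

Local Notation rRect := 0%N (only parsing).
Local Notation rX := 1%N (only parsing).
Local Notation rY := 2%N (only parsing).
Local Notation rOut := 3%N (only parsing).
Local Notation rH := 4%N (only parsing).
Local Notation rLeft := 5%N (only parsing).
Local Notation rRank := 6%N (only parsing).
Local Notation rK1 := 7%N (only parsing).
Local Notation rTmp := 8%N (only parsing).
Local Notation rOne := 9%N (only parsing).

Local Notation "A ;; B" := (Seq A B) (at level 70, right associativity).

Section Programs.
Local Open Scope nat_scope.

Definition init_consts :=
  Do (NConst (Var aOne) 1) ;; Do (NAdd (Var aN1) (Var aN) (Var aOne)) ;;
  Do (RConst (Var rOne) 1) ;; Do (RConst (Var rK1) 1) ;;
  Do (NConst (Var aBig) 1).

Definition bound_body :=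
  Do (NAdd (Var aBig) (Var aBig) (Var aN)) ;;
  Do (RAdd (Var rK1) (Var rK1) (Var rOne)) ;;
  Do (NAdd (Var aI) (Var aI) (Var aOne)).

(** The machine neither multiplies natural numbers nor converts them to coordinates, so n|C| + 1 and
    the coordinate |C| + 1 are built by repeated addition. *)
Definition bound_costs :=
  init_consts ;; While (NLt (Var aI) (Var aK)) bound_body.

Definition init_top :=
  Do (NConst (Var aG) 3) ;; Do (RCopy (Var rH) (Elt rRect aG)).

Definition gap_ends_body :=
  Do (NAdd (Var aG1) (Var aP) (Var aOne)) ;;
  Do (RCopy (Elt rH aG1) (Elt rY aP)) ;; Do (NCopy (Var aP) (Var aG1)).

Definition list_gap_ends :=
  init_top ;; While (NLt (Var aP) (Var aN)) gap_ends_body.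

Definition init_bottom :=
  Do (NConst (Var aG) 2) ;; Do (RCopy (Elt rH aN1) (Elt rRect aG)) ;;
  Do (NConst (Var aI) 0).

(** [aOne] holds 1, which is here the index of [xright] in the rectangle array. *)
Definition left_init :=
  Do (RAdd (Var rLeft) (Elt rRect aOne) (Var rOne)) ;; Do (NConst (Var aP) 0).

Definition left_body :=
  (If (NLt (Elt aCol aP) (Var aI)) Skip
    (If (NLt (Var aI) (Elt aCol aP)) Skip
      (If (RLt (Elt rX aP) (Var rLeft))
        (Do (RCopy (Var rLeft) (Elt rX aP))) Skip))) ;;
  Do (NAdd (Var aP) (Var aP) (Var aOne)).

Definition find_left_end :=
  left_init ;; While (NLt (Var aP) (Var aN)) left_body.

Definition cost_init := Do (NConst (Var aP) 0) ;; Do (NConst (Var aCost) 0).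

Definition cost_body :=
  (If (RLt (Elt rX aP) (Var rLeft)) Skip
    (If (NLt (Elt aCol aP) (Var aI))
      (Do (NAdd (Var aCost) (Var aCost) (Var aOne))) Skip)) ;;
  Do (NAdd (Var aP) (Var aP) (Var aOne)).

Definition count_cost :=
  cost_init ;; While (NLt (Var aP) (Var aN)) cost_body.

Definition row_init :=
  Do (NConst (Var aP) 0) ;; Do (NConst (Var aArg) 0) ;;
  Do (NAdd (Var aVal) (Var aBest) (Var aBig)).

Definition row_body :=
  Do (NAdd (Var aG1) (Var aP) (Var aOne)) ;;
  (If (RLt (Elt rH aG1) (Elt rH aP)) (Do (NCopy (Var aTmp) (Var aCost)))
    (Do (NCopy (Var aTmp) (Var aBig)))) ;;
  Do (NAdd (Var aTmp) (Elt aBest aP) (Var aTmp)) ;;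
  (If (NLt (Var aTmp) (Var aVal))
    (Do (NCopy (Var aVal) (Var aTmp)) ;; Do (NCopy (Var aArg) (Var aP)))
    Skip) ;;
  Do (NCopy (Elt aBest aP) (Var aVal)) ;;
  Do (NAdd (Var aIdx) (Var aBase) (Var aP)) ;;
  Do (NCopy (Elt aChoice aIdx) (Var aArg)) ;;
  (If (RLt (Elt rX aP) (Var rLeft)) Skip
    (If (NLt (Elt aCol aP) (Var aI))
      (Do (NSub (Var aCost) (Var aCost) (Var aOne)))
      (If (NLt (Var aI) (Elt aCol aP))
        (Do (NAdd (Var aCost) (Var aCost) (Var aOne))) Skip))) ;;
  Do (NCopy (Var aP) (Var aG1)).

Definition fill_row :=
  row_init ;; While (NLt (Var aP) (Var aN1)) row_body.

Definition color_end :=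
  Do (NAdd (Var aBase) (Var aBase) (Var aN1)) ;;
  Do (NAdd (Var aI) (Var aI) (Var aOne)).

Definition color_body := find_left_end ;; count_cost ;; fill_row ;; color_end.

Definition place_init := Do (NCopy (Var aG) (Var aN)).

Definition place_body :=
  Do (NSub (Var aI) (Var aI) (Var aOne)) ;;
  Do (NSub (Var aBase) (Var aBase) (Var aN1)) ;;
  Do (NAdd (Var aIdx) (Var aBase) (Var aG)) ;;
  Do (NCopy (Var aG) (Elt aChoice aIdx)) ;;
  Do (NAdd (Var aG1) (Var aG) (Var aOne)) ;;
  Do (RAdd (Var rRank) (Var rRank) (Var rOne)) ;;
  Do (RSub (Var rTmp) (Elt rH aG) (Elt rH aG1)) ;;
  Do (RMul (Var rTmp) (Var rTmp) (Var rRank)) ;;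
  Do (RDiv (Var rTmp) (Var rTmp) (Var rK1)) ;;
  Do (RAdd (Elt rOut aI) (Elt rH aG1) (Var rTmp)).

Definition place_backbones :=
  place_init ;; While (NLt (Var aZero) (Var aI)) place_body.

Definition backbone_prog :=
  bound_costs ;; list_gap_ends ;; init_bottom ;;
  While (NLt (Var aI) (Var aK)) color_body ;; place_backbones.

End Programs.

(** * Costs, gaps and heights as mathematical functions *)

Section Specification.
Variables (F : realFieldType) (I : instance F).
Local Notation n := (npts I).
Local Notation k := (ncol I).

Definition colat : nat -> nat := ext 0%N (fun p : 'I_n => color p : nat).
Definition xat : nat -> F := ext 0 (@px F I).
Definition yat : nat -> F := ext 0 (@py F I).

(* Gap [g] is the interval between [gap_end g.+1] and [gap_end g]: there are
   [g] points above it. *)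
Definition gap_end (g : nat) : F :=
  if g is p.+1 then if (p < n)%N then yat p else ybot I else ytop I.

(* The abscissa where the backbone of color [i] starts, among the first [p]
   points; it lies outside the rectangle if none of them has color [i]. *)
Fixpoint left_end (i p : nat) : F :=
  if p is q.+1 then
    if (colat q == i) && (xat q < left_end i q) then xat q else left_end i q
  else xright I + 1.

Definition under (i p : nat) : bool := left_end i n <= xat p.

Local Open Scope nat_scope.

Definition gap_cost (i g : nat) : nat :=
  \sum_(p < n) (under i p && if p < g then i < colat p else colat p < i).

Definition big_cost : nat := (n * k).+1.

Definition cost (i g : nat) : nat :=
  if (gap_end g.+1 < gap_end g)%R then gap_cost i g else big_cost.

Definition gap_of (i : nat) : nat := trace big_cost cost k n i.

(** The factor (|C| - i) / (|C| + 1) lies strictly between 0 and 1 and decreases in [i], so colors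
    that share a gap get interior heights in the given order. *)
Definition height (i : nat) : F :=
  let g := gap_of i in
  (gap_end g.+1 + (gap_end g - gap_end g.+1) * (k - i)%:R / k.+1%:R)%R.

Local Notation best := (best big_cost cost).
Local Notation choice := (choice big_cost cost).

Lemma gap_cost_le i g : gap_cost i g <= n.
Proof.
rewrite -[leqRHS]card_ord -sum1_card; apply: leq_sum => p _.
by case: (_ && _).
Qed.

Lemma ncol_gt0 : 0 < n -> 0 < k.
Proof. by move=> n_gt0; apply: leq_ltn_trans (ltn_ord (color (Ordinal n_gt0))). Qed.

Lemma cost_le i g : 0 < n -> cost i g <= big_cost.
Proof.
rewrite /cost /big_cost => n_gt0; case: ifP => // _.
have k_gt0 := ncol_gt0 n_gt0.
by apply: leq_trans (gap_cost_le i g) _; apply/leqW/leq_pmulr.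
Qed.

(** Only the point [p] changes sides between the two gaps. If its color is below [i] and it is under
    the backbone, it was counted before, so the truncated subtraction is exact. *)
Lemma gap_costS i p : p < n ->
  gap_cost i p.+1 =
  if ~~ under i p then gap_cost i p
  else if colat p < i then gap_cost i p - 1
  else if i < colat p then gap_cost i p + 1 else gap_cost i p.
Proof.
move=> lt_pn; have splitD g := bigD1 (Ordinal lt_pn) (erefl true)
  : gap_cost i g = _; rewrite !{}splitD /= ltnSn ltnn.
rewrite (eq_bigr (fun q : 'I_n =>
    (under i q && if q < p then i < colat q else colat q < i) : nat)); last first.
  move=> q; rewrite -val_eqE /= => /negbTE ne_qp.
  by rewrite ltnS leq_eqVlt ne_qp.
by case: (under i p) => //=; case: (ltngtP (colat p) i) => _ /=; lia.
Qed.

End Specification.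

(** * Verification of the program *)

Section Verification.
Variables (F : realFieldType) (I : instance F).
Hypothesis npts_gt0 : (0 < npts I)%N.
Local Notation n := (npts I).
Local Notation k := (ncol I).
Local Notation colat := (colat I).
Local Notation xat := (xat I).
Local Notation gap_end := (gap_end I).
Local Notation left_end := (left_end I).
Local Notation best := (best (big_cost I) (cost I)).
Local Notation choice := (choice (big_cost I) (cost I)).
Local Notation scan_row := (scan_row (big_cost I) (cost I)).
Implicit Type m : store F.
Local Open Scope nat_scope.

Record inputs m : Prop := Inputs {
  in_n : nats m aN 0 = n;
  in_k : nats m aK 0 = k;
  in_col : forall p, nats m aCol p = colat p;
  in_zero : nats m aZero 0 = 0;
  in_xright : reals m rRect 1 = xright I;
  in_ybot : reals m rRect 2 = ybot I;
  in_ytop : reals m rRect 3 = ytop I;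
  in_x : forall p, reals m rX p = xat p;
  in_y : forall p, reals m rY p = yat I p
}.

Record constants m : Prop := Constants {
  const_inputs :> inputs m;
  const_one : nats m aOne 0 = 1;
  const_n1 : nats m aN1 0 = n.+1;
  const_rone : reals m rOne 0 = 1%R
}.

Record ambient m : Prop := Ambient {
  amb_const :> constants m;
  amb_big : nats m aBig 0 = big_cost I;
  amb_rk1 : reals m rK1 0 = (k.+1%:R)%R;
  amb_gap : forall g, g <= n.+1 -> reals m rH g = gap_end g
}.

Definition table x := choice (x %/ n.+1) (x %% n.+1).

Record rows_done i m : Prop := RowsDone {
  rows_amb :> ambient m;
  rows_i : nats m aI 0 = i;
  rows_base : nats m aBase 0 = i * n.+1;
  rows_best : forall g, g <= n -> nats m aBest g = best i g;
  rows_choice : forall x, x < i * n.+1 -> nats m aChoice x = table x;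
  rows_rank : reals m rRank 0 = 0%R
}.

(** Invariant of the inner loop. The clause [part_cost] stops at [n] because the final cost update
    happens past the last point. *)
Record row_part i p m : Prop := RowPart {
  part_amb :> ambient m;
  part_i : nats m aI 0 = i;
  part_base : nats m aBase 0 = i * n.+1;
  part_p : nats m aP 0 = p;
  part_left : reals m rLeft 0 = left_end i n;
  part_cost : p <= n -> nats m aCost 0 = gap_cost I i p;
  part_val : nats m aVal 0 = (scan_row (best i) i p).1;
  part_arg : nats m aArg 0 = (scan_row (best i) i p).2;
  part_best : forall g, g <= n ->
    nats m aBest g = if g < p then best i.+1 g else best i g;
  part_choice : forall x, x < i * n.+1 + p -> nats m aChoice x = table x;
  part_rank : reals m rRank 0 = 0%R
}.

(** Discharges the clauses of an invariant about cells that the executed instructions leave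
    alone. *)
Local Ltac frame :=
  try (move=> * ); eval_store;
  try solve [assumption | match goal with H : _ |- _ => apply: H; assumption end
            | match goal with H : _ |- _ => apply: H end].

Local Ltac frame_constants :=
  case=> [[]] *; split; [split |..]; frame.

Local Ltac frame_ambient :=
  case=> [[[]]] *; split; [split; [split|..] |..]; frame.

Local Ltac frame_rows :=
  case=> [[[[]]]] *; split; [split; [split; [split|..] |..] |..]; frame.

Lemma find_left_end_runs i m : rows_done i m ->
  runs find_left_end m (steps left_init + (n * (steps left_body).+1).+1)
    (fun m' => rows_done i m' /\ reals m' rLeft 0 = left_end i n).
Proof.
move=> Rm; apply/runs_seq/runs_wp; do ?wp_step.
pose J p m' := [/\ rows_done i m', nats m' aP 0 = p
  & reals m' rLeft 0 = left_end i p].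
apply: (runs_while (J := J)) => [p m' lt_pn [R def_p def_L] | m' [R def_p ?] |].
- have def_n := in_n R; have def_i := rows_i R; have def_one := const_one R.
  have def_C := in_col R p; have def_X := in_x R p.
  split; first by eval_store; rewrite def_p def_n.
  apply: runs_wp; rewrite /left_body.
  (* All branches end with the same increment, after either no change or an update of [rLeft]. *)
  have step m1 : m1 = m' \/ m1 = run_instr (RCopy (Var rLeft) (Elt rX aP)) m' ->
      reals m1 rLeft 0 = left_end i p.+1 ->
    J p.+1 (run_instr (NAdd (Var aP) (Var aP) (Var aOne)) m1).
    case=> -> L1; (split; first by move: R; frame_rows).
    - by eval_store; rewrite def_p def_one addn1.
    - by move: L1; eval_store.
    - by eval_store; rewrite def_p def_one addn1.
    - by move: L1; eval_store.
  do ?wp_step; eval_store; rewrite def_p def_i def_C.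
  case: ltnP => [lt_ci | le_ic]; do ?wp_step.
    by apply: step; [left | rewrite def_L /= ltn_eqF].
  eval_store; rewrite def_p def_i def_C.
  case: ltnP => [lt_ic | le_ci]; do ?wp_step.
    by apply: step; [left | rewrite def_L /= gtn_eqF].
  have eq_c: colat p == i by rewrite eqn_leq le_ci le_ic.
  eval_store; rewrite def_p def_X def_L.
  case: ltP => [lt_X | le_X]; do ?wp_step.
    apply: step; first by right.
    by eval_store; rewrite def_p def_X /= eq_c lt_X.
  by apply: step; [left | rewrite def_L /= eq_c ltNge le_X].
- by split=> //; eval_store; rewrite def_p (in_n R) ltnn.
split; try by eval_store.
  by move: Rm; frame_rows.
by eval_store; rewrite (const_one Rm) (in_xright Rm) (const_rone Rm).
Qed.
Lemma count_cost_runs i m :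
    rows_done i m -> reals m rLeft 0 = left_end i n ->
  runs count_cost m (steps cost_init + (n * (steps cost_body).+1).+1)
    (fun m' => [/\ rows_done i m', reals m' rLeft 0 = left_end i n
                 & nats m' aCost 0 = gap_cost I i 0]).
Proof.
move=> Rm Lm; apply/runs_seq/runs_wp; do ?wp_step.
pose J p m' := [/\ rows_done i m', reals m' rLeft 0 = left_end i n,
  nats m' aP 0 = p
  & nats m' aCost 0 = \sum_(q < p) (under I i q && (colat q < i))].
apply: (runs_while (J := J)) => [p m' lt_pn [R L def_p def_s]|m' [R ? def_p ?]|].
- have def_n := in_n R; have def_i := rows_i R; have def_one := const_one R.
  have def_C := in_col R p; have def_X := in_x R p.
  split; first by eval_store; rewrite def_p def_n.
  apply: runs_wp; rewrite /cost_body.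
  have def_u : (xat p < reals m' rLeft 0)%R = ~~ under I i p.
    by rewrite L ltNge.
  have JS m1 : rows_done i m1 -> reals m1 rLeft 0 = left_end i n ->
      nats m1 aP 0 = p + 1 ->
      nats m1 aCost 0 = nats m' aCost 0 + (under I i p && (colat p < i)) ->
    J p.+1 m1.
    move=> R1 L1 p1 C1; split; rewrite ?p1 ?addn1 //.
    by rewrite C1 def_s big_ord_recr.
  do ?wp_step; eval_store; rewrite def_p def_X def_u.
  case: (under I i p) JS => JS; eval_store; do ?wp_step.
    eval_store; rewrite def_p def_C def_i.
    by case: ltnP JS => _ JS; do ?wp_step;
      apply: JS; (try by move: R; frame_rows);
      eval_store; rewrite ?def_p ?def_one ?addn0.
  by apply: JS; (try by move: R; frame_rows);
     eval_store; rewrite ?def_p ?def_one ?addn0.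
- by split=> //; eval_store; rewrite def_p (in_n R) ltnn.
split; first by move: Rm; frame_rows.
all: by eval_store; rewrite ?big_ord0.
Qed.

Lemma row_body_wp i p m : p <= n -> row_part i p m ->
  wp row_body (row_part i p.+1) m.
Proof.
move=> le_pn R.
have [def_i def_base def_p] := And3 (part_i R) (part_base R) (part_p R).
have [def_left def_big def_one] := And3 (part_left R) (amb_big R) (const_one R).
have [def_X def_C] := (in_x R p, in_col R p).
have [def_H def_H1] : reals m rH p = gap_end p /\ reals m rH (p + 1) = gap_end p.+1.
  by rewrite addn1 !(amb_gap R) //; apply: leqW.
have def_u : (xat p < left_end i n)%R = ~~ under I i p by rewrite ltNge.
pose w := best i p + cost I i p.
have def_w : nats m aBest p + (if (gap_end p.+1 < gap_end p)%R
    then nats m aCost 0 else nats m aBig 0) = w.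
  by rewrite (part_best R) // ltnn (part_cost R) // (amb_big R).
(* The mathematics is done once, for any store with these entries; [r] is one step of [scan]. The
   paths through the body are then checked by evaluation alone. *)
have JS m1 : ambient m1 -> nats m1 aI 0 = i -> nats m1 aBase 0 = i * n.+1 ->
    nats m1 aP 0 = p + 1 -> reals m1 rLeft 0 = left_end i n ->
    reals m1 rRank 0 = 0%R ->
    nats m1 aCost 0 = (if ~~ under I i p then nats m aCost 0
      else if colat p < i then nats m aCost 0 - 1
      else if i < colat p then nats m aCost 0 + 1 else nats m aCost 0) ->
    let r := if w < nats m aVal 0 then (w, p) else (nats m aVal 0, nats m aArg 0)
    in nats m1 aVal 0 = r.1 -> nats m1 aArg 0 = r.2 ->
    (forall g, nats m1 aBest g = if g == p then r.1 else nats m aBest g) ->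
    (forall x, nats m1 aChoice x =
       if x == i * n.+1 + p then r.2 else nats m aChoice x) ->
  row_part i p.+1 m1.
  move=> Am1 i1 base1 p1 left1 rank1 cost1 r.
  have -> : r = scan_row (best i) i p.+1.
    rewrite /r /w (part_val R) (part_arg R) /scan_row /= -/(scan_row _ _ _).
    by case: (scan_row (best i) i p).
  move=> val1 arg1 best1 choice1; split=> //; first by rewrite p1 addn1.
  - move=> lt_pn; rewrite gap_costS // cost1 (part_cost R) //.
  - move=> g le_gn; rewrite best1 ltnS leq_eqVlt; case: eqP => [-> // | _].
    exact: part_best R g le_gn.
  move=> x; rewrite choice1 addnS ltnS leq_eqVlt; case: eqP => [-> _ | _] /=.
    by rewrite /table divnMDl // modnMDl divn_small ?modn_small ?addn0.
  exact: part_choice R x.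
rewrite /row_body; do ?wp_step; eval_store; rewrite def_p def_one def_H def_H1.
have Am := part_amb R; have rank := part_rank R.
case: ifP def_w => _ def_w; do ?wp_step; eval_store; rewrite def_p def_w;
  case: (w < nats m aVal 0) JS => JS; eval_store; do ?wp_step;
  eval_store; rewrite def_p def_X def_left def_u;
  (case: (under I i p) JS => JS; eval_store; do ?wp_step; eval_store;
   [rewrite def_p def_C def_i; case: (colat p < i) JS => JS;
    [|eval_store; do ?wp_step; eval_store; rewrite def_p def_C def_i;
      case: (i < colat p) JS => JS] |]; eval_store; do ?wp_step);
  apply: JS; first [by move: Am; frame_ambient
    | by move=> *; eval_store; rewrite ?def_p ?def_base ?def_one ?def_w].
Qed.

Lemma fill_row_runs i m :
    rows_done i m -> reals m rLeft 0 = left_end i n ->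
    nats m aCost 0 = gap_cost I i 0 ->
  runs fill_row m (steps row_init + (n.+1 * (steps row_body).+1).+1)
    (row_part i n.+1).
Proof.
move=> Rm Lm Sm; apply/runs_seq/runs_wp; do ?wp_step.
apply: (runs_while (J := row_part i)) => [p m' lt_pn R | m' R |].
- split; first by eval_store; rewrite (part_p R) (const_n1 R).
  apply: runs_wp; exact: row_body_wp.
- by split=> //; eval_store; rewrite (part_p R) (const_n1 R) ltnn.
split; try by [move: (rows_amb Rm); frame_ambient | case: (Rm) => *; frame].
- by eval_store; rewrite (rows_best Rm) // (amb_big Rm).
- by move=> x; rewrite addn0; eval_store; apply: rows_choice.
Qed.

Lemma color_body_runs i m : rows_done i m ->
  runs color_body m (steps left_init + (n * (steps left_body).+1).+1 +
    (steps cost_init + (n * (steps cost_body).+1).+1 +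
     (steps row_init + (n.+1 * (steps row_body).+1).+1 + steps color_end)))
    (rows_done i.+1).
Proof.
move=> Rm; apply: runs_seq.
apply: runs_imp (leqnn _) _ (find_left_end_runs Rm) => m1 [R1 L1].
apply: runs_seq; apply: runs_imp (leqnn _) _ (count_cost_runs R1 L1).
move=> m2 [R2 L2 S2].
apply: runs_seq; apply: runs_imp (leqnn _) _ (fill_row_runs R2 L2 S2).
move=> m3 R3; apply: runs_wp; rewrite /color_end; do ?wp_step.
split.
- by move: (part_amb R3); frame_ambient.
- by eval_store; rewrite (part_i R3) (const_one R3) addn1.
- by eval_store; rewrite (part_base R3) (const_n1 R3) mulSn addnC.
- by move=> g le_gn; eval_store; rewrite (part_best R3) // ltnS le_gn.
- by move=> x; rewrite mulSn addnC => lt_x; eval_store; apply: part_choice R3 x lt_x.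
by eval_store; apply: part_rank R3.
Qed.

(** * Initialization of the store *)

Record fresh m : Prop := Fresh {
  fresh_base : nats m aBase 0 = 0;
  fresh_best : forall g, nats m aBest g = 0;
  fresh_rank : reals m rRank 0 = 0%R
}.

Local Ltac frame_fresh := case=> *; split; frame.

Lemma bound_costs_runs m :
    inputs m -> fresh m -> nats m aI 0 = 0 -> nats m aP 0 = 0 ->
  runs bound_costs m (steps init_consts + (k * (steps bound_body).+1).+1)
    (fun m' => [/\ constants m', nats m' aBig 0 = big_cost I,
       reals m' rK1 0 = (k.+1%:R)%R, fresh m' & nats m' aP 0 = 0]).
Proof.
move=> Im Fm i0 p0; apply/runs_seq/runs_wp; rewrite /init_consts; do ?wp_step.
pose J i m' := [/\ constants m', nats m' aBig 0 = (n * i).+1,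
  reals m' rK1 0 = (i.+1%:R)%R, fresh m' & nats m' aP 0 = 0 /\ nats m' aI 0 = i].
apply: (runs_while (J := J)) =>
  [i m' lt_ik [Cm B R Fm' [p0' def_i]] | m' [Cm B R Fm' [p0' def_i]] |].
- split; first by eval_store; rewrite def_i (in_k Cm).
  apply: runs_wp; rewrite /bound_body; do ?wp_step; split.
  + by move: Cm; frame_constants.
  + by eval_store; rewrite B (in_n Cm) mulnS addSn addnC.
  + by eval_store; rewrite R (const_rone Cm) natr1.
  + by move: Fm'; frame_fresh.
  by eval_store; rewrite def_i (const_one Cm) addn1.
- by split=> //; eval_store; rewrite def_i (in_k Cm) ltnn.
split; rewrite ?muln0 //; try by eval_store.
- split; first by case: Im => *; split; frame.
  + by eval_store.
  + by eval_store; rewrite (in_n Im) addn1.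
  by eval_store.
by move: Fm; frame_fresh.
Qed.

Lemma list_gap_ends_runs m :
    [/\ constants m, nats m aBig 0 = big_cost I, reals m rK1 0 = (k.+1%:R)%R,
       fresh m & nats m aP 0 = 0] ->
  runs list_gap_ends m (steps init_top + (n * (steps gap_ends_body).+1).+1)
    (fun m' => [/\ constants m', nats m' aBig 0 = big_cost I,
       reals m' rK1 0 = (k.+1%:R)%R, fresh m'
       & forall g, g <= n -> reals m' rH g = gap_end g]).
Proof.
case=> Cm Bm Km Fm p0; apply/runs_seq/runs_wp; rewrite /init_top; do ?wp_step.
pose J p m' := [/\ constants m', nats m' aBig 0 = big_cost I,
  reals m' rK1 0 = (k.+1%:R)%R, fresh m'
  & nats m' aP 0 = p /\ forall g, g <= p -> reals m' rH g = gap_end g].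
apply: (runs_while (J := J)) =>
  [p m' lt_pn [C' B K F' [def_p H]] | m' [C' B K F' [def_p H]] |].
- split; first by eval_store; rewrite def_p (in_n C').
  have def_one := const_one C'.
  apply: runs_wp; rewrite /gap_ends_body; do ?wp_step; split.
  + by move: C'; frame_constants.
  + by eval_store.
  + by eval_store.
  + by move: F'; frame_fresh.
  split=> [|g]; eval_store; first by rewrite def_p def_one addn1.
  rewrite def_p def_one addn1 leq_eqVlt; case: eqP => [-> _ | _ /H //].
  by rewrite (in_y C') /= lt_pn.
- by split=> //; eval_store; rewrite def_p (in_n C') ltnn.
split; try by eval_store.
- by move: Cm; frame_constants.
- by move: Fm; frame_fresh.
split=> [|g]; first by eval_store.
by rewrite leqn0 => /eqP->; eval_store; rewrite (in_ytop Cm).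
Qed.

Lemma init_bottom_runs m :
    [/\ constants m, nats m aBig 0 = big_cost I, reals m rK1 0 = (k.+1%:R)%R,
       fresh m & forall g, g <= n -> reals m rH g = gap_end g] ->
  runs init_bottom m (steps init_bottom) (rows_done 0).
Proof.
case=> Cm Bm Km Fm H; apply: runs_wp; rewrite /init_bottom; do ?wp_step.
split; try by eval_store.
- split; try by eval_store.
    by move: Cm; frame_constants.
  move=> g le_gn; eval_store; rewrite (const_n1 Cm) (in_ybot Cm).
  by case: eqP le_gn => [-> _ | ne_gn le_gn]; rewrite /= ?ltnn //; apply: H; lia.
(* The row of zeros for no color, the base and the rank come from cells that are still zero from the
   input. *)
- by eval_store; rewrite (fresh_base Fm).
- by move=> g _; eval_store; apply: fresh_best Fm g.
by eval_store; apply: fresh_rank Fm.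
Qed.

(** * Reading the gaps back from the table *)

Record placed t g m : Prop := Placed {
  placed_amb :> ambient m;
  placed_i : nats m aI 0 = k - t;
  placed_base : nats m aBase 0 = (k - t) * n.+1;
  placed_choice : forall x, x < k * n.+1 -> nats m aChoice x = table x;
  placed_g : nats m aG 0 = g;
  placed_rank : reals m rRank 0 = (t%:R)%R;
  placed_out : forall j, k - t <= j < k -> reals m rOut j = height I j
}.

(** Colors are treated from the last to the first. The gaps still to be found form the trace of the
    first [k - t] colors from [g], whose last entry is stored in row [k - t.+1], column [g]. The
    rank after the step is [t.+1], the numerator in [height]. *)
Lemma place_body_wp t g m :
    t < k -> g <= n ->
    (forall j, j < k - t -> gap_of I j = trace (big_cost I) (cost I) (k - t) g j) ->
    placed t g m ->
  wp place_body (placed t.+1 (choice (k - t.+1) g)) m.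
Proof.
move=> lt_tk le_gn def_gap P; set j := k - t.+1.
have def_kt : k - t = j.+1 by rewrite subnSK.
have lt_jk : j < k by rewrite /j; lia.
have [c_le _ _] := best_choice (fun i g => cost_le i g npts_gt0) j g.
have [def_i def_base def_g] := And3 (placed_i P) (placed_base P) (placed_g P).
have [def_one def_n1] := (const_one P, const_n1 P).
have def_c : nats m aChoice (j * n.+1 + g) = choice j g.
  rewrite (placed_choice P); last by rewrite -subn_gt0; nia.
  by rewrite /table divnMDl // modnMDl divn_small ?modn_small ?addn0.
have gap_j : gap_of I j = choice j g.
  by rewrite def_gap def_kt //= eqxx.
have i1 : nats m aI 0 - 1 = j by rewrite def_i /j subn1 subnS.
have base1 : nats m aBase 0 - n.+1 = j * n.+1.
  by rewrite def_base def_kt mulSn addKn.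
rewrite /place_body; do ?wp_step; split.
- by move: (placed_amb P); frame_ambient.
- by eval_store; rewrite def_one i1.
- by eval_store; rewrite def_n1 base1.
- by move=> x lt_x; eval_store; apply: placed_choice P x lt_x.
- by eval_store; rewrite def_n1 base1 def_g def_c.
- by eval_store; rewrite (placed_rank P) (const_rone P) natr1.
move=> j' ltj'; eval_store.
rewrite def_one i1 def_n1 base1 def_g def_c (placed_rank P) (const_rone P).
rewrite (amb_rk1 P) !(amb_gap P) ?addn1 ?natr1; try lia.
case: eqP => [-> | ne_j'j]; last by apply: (placed_out P); lia.
by rewrite /height gap_j /j subKn.
Qed.

Lemma place_backbones_runs m : rows_done k m ->
  runs place_backbones m (steps place_init + (k * (steps place_body).+1).+1)
    (fun m' => forall i, i < k -> reals m' rOut i = height I i).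
Proof.
move=> Rm; apply/runs_seq/runs_wp; rewrite /place_init; do ?wp_step.
pose J t m' := exists g, [/\ g <= n, placed t g m' & forall j, j < k - t ->
  gap_of I j = trace (big_cost I) (cost I) (k - t) g j].
apply: (runs_while (J := J)) =>
  [t m' lt_tk [g [le_gn P def_gap]] | m' [g [_ P _]] |].
- split; first by eval_store; rewrite (in_zero P) (placed_i P) subn_gt0.
  have [m1 [T [e leT P1]]] := runs_wp (place_body_wp lt_tk le_gn def_gap P).
  exists m1, T; split=> //; exists (choice (k - t.+1) g).
  have [c_le _ _] := best_choice (fun i g => cost_le i g npts_gt0) (k - t.+1) g.
  split=> [||j lt_j] //; first exact: leq_trans c_le le_gn.
  by rewrite def_gap -subnSK //= ?ltn_eqF // ltnS ltnW.
- split; first by eval_store; rewrite (in_zero P) (placed_i P) subnn.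
  by move=> i lt_ik; apply: (placed_out P); rewrite subnn.
exists n; rewrite subn0; split=> //; split; rewrite ?subn0.
- by move: (rows_amb Rm); frame_ambient.
- by eval_store; exact: (rows_i Rm).
- by eval_store; exact: (rows_base Rm).
- by move=> x lt_x; eval_store; apply: rows_choice Rm x lt_x.
- by eval_store; rewrite (in_n Rm).
- by eval_store; apply: rows_rank Rm.
by move=> j; lia.
Qed.

Lemma backbone_prog_runs m :
    inputs m -> fresh m -> nats m aI 0 = 0 -> nats m aP 0 = 0 ->
  runs backbone_prog m (150 * (n * k))
    (fun m' => forall i, i < k -> reals m' rOut i = height I i).
Proof.
move=> Im Fm i0 p0; have k_gt0 := ncol_gt0 npts_gt0.
(* Since [n] and [k] are positive, the terms of order 1, [n] and [k] in the running time are
   absorbed by [n * k]; the constant 150 leaves room. *)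
have le_n_nk : n <= n * k by apply: leq_pmulr.
have le_k_nk : k <= n * k by apply: leq_pmull.
apply: (runs_imp _ (fun _ => id)); last first.
  apply: runs_seq.
  apply: runs_imp (leqnn _) _ (bound_costs_runs Im Fm i0 p0) => m1 Im1.
  apply: runs_seq; apply: runs_imp (leqnn _) _ (list_gap_ends_runs Im1).
  move=> m2 Im2; apply: runs_seq.
  apply: runs_imp (leqnn _) _ (init_bottom_runs Im2) => m3 Rm3.
  apply: runs_seq; apply: (runs_while (N := k) (J := rows_done)) (Rm3).
    move=> i m' lt_ik R; split; first by eval_store; rewrite (rows_i R) (in_k R).
    exact: (color_body_runs R).
  move=> m' R; split; first by eval_store; rewrite (rows_i R) (in_k R) ltnn.
  exact: (place_backbones_runs R).
rewrite /=; lia.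
Qed.

End Verification.

(** * From gaps to labelings *)

Lemma ext_ord (T : Type) n (d : T) (f : 'I_n -> T) (p : 'I_n) : ext d f p = f p.
Proof. by rewrite /ext valK. Qed.

Section Gaps.
Variables (F : realFieldType) (I : instance F).
Hypothesis npts_gt0 : (0 < npts I)%N.
Local Notation n := (npts I).
Local Notation k := (ncol I).
Local Notation gap_end := (gap_end I).
Implicit Types (p q : 'I_n) (i j : 'I_k).

Lemma gap_endS p : gap_end p.+1 = py p.
Proof. by rewrite /= ltn_ord; apply: ext_ord. Qed.

Lemma gap_end_last : gap_end n.+1 = ybot I.
Proof. by rewrite /= ltnn. Qed.

Lemma gap_end_ge g : ybot I <= gap_end g.
Proof.
case: g => [|p]; first exact/ltW/rect_height.
case: (ltnP p n) => [lt_pn | le_np]; last by rewrite /= ltnNge le_np.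
by rewrite (gap_endS (Ordinal lt_pn)); case/andP: (py_in_rect (Ordinal lt_pn)).
Qed.

Lemma gap_end_anti : {homo gap_end : g h / (g <= h)%N >-> h <= g}.
Proof.
apply: homo_leq => [//|x y z yx zy|g]; first exact: le_trans zy yx.
case: (ltnP g n) => [lt_gn | le_ng]; last first.
  by rewrite [gap_end g.+1]/= ltnNge le_ng; apply: gap_end_ge.
rewrite (gap_endS (Ordinal lt_gn)).
case: g lt_gn => [|p] lt_pn; first by case/andP: (py_in_rect (Ordinal lt_pn)).
rewrite (gap_endS (Ordinal (ltnW lt_pn))).
by apply/ltW/py_decr => /=.
Qed.

(** * Gaps of positive length *)

Definition proper_gap g := gap_end g.+1 < gap_end g.

(* The highest proper gap that reaches down to [y]. *)
Definition gap_at y : nat :=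
  find (fun g => proper_gap g && (gap_end g.+1 <= y)) (iota 0 n.+1).

Lemma gap_atP y : ybot I <= y ->
  [/\ (gap_at y <= n)%N, proper_gap (gap_at y), gap_end (gap_at y).+1 <= y
    & forall g, proper_gap g -> gap_end g.+1 <= y -> (gap_at y <= g)%N].
Proof.
move=> y_ge; pose P g := proper_gap g && (gap_end g.+1 <= y).
(* The first gap end equal to [ybot I] is the lower end of a proper gap, which reaches down to every
   admissible [y]. It is not the end of index 0, as the rectangle has positive height. *)
have exh : exists h, gap_end h == ybot I by exists n.+1; rewrite gap_end_last.
have hasP : has P (iota 0 n.+1).
  case: (ex_minnP exh) => -[/eqP eq_h|g /eqP eq_g min_g].
    by have := rect_height I; rewrite -eq_h ltxx.
  apply/hasP; exists g.
    by rewrite mem_iota add0n -[X in (_ < X)%N]/n.+1 min_g ?gap_end_last.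
  rewrite /P /proper_gap eq_g y_ge andbT lt_neqAle gap_end_ge andbT eq_sym.
  by apply: contraTneq (leqnn g) => eq_g'; rewrite -ltnNge min_g ?eq_g'.
have lt_n : (gap_at y < n.+1)%N by move: hasP; rewrite has_find size_iota.
have := nth_find 0%N hasP; rewrite -/(gap_at y) nth_iota // add0n.
case/andP=> ok_g le_y; split=> // g ok_g' le_y'.
rewrite leqNgt; apply/negP => lt_g; have := before_find 0%N lt_g.
by rewrite nth_iota ?(ltn_trans lt_g) // add0n ok_g' le_y'.
Qed.

(** Otherwise the first gap end below [y] would be the lower end of a proper gap higher than
    [gap_at y], against the minimality of [gap_at y]. *)
Lemma gap_at_ge y : ybot I <= y -> y <= ytop I -> y <= gap_end (gap_at y).
Proof.
move=> y_ge y_le; have [_ _ _ min_g] := gap_atP y_ge.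
rewrite leNgt; apply/negP => lt_y.
have exh : exists h, gap_end h < y by exists (gap_at y).
case: (ex_minnP exh) => -[|h lt_h min_h]; first by rewrite ltNge y_le.
have le_h : y <= gap_end h.
  by rewrite leNgt; apply/negP=> /min_h; rewrite ltnn.
have := min_g h (lt_le_trans lt_h le_h) (ltW lt_h).
by rewrite leqNgt (min_h _ lt_y).
Qed.

Lemma gap_at_anti x y : ybot I <= x -> x <= y -> (gap_at y <= gap_at x)%N.
Proof.
move=> x_ge le_xy; have [_ ok_x le_x _] := gap_atP x_ge.
have [_ _ _ -> //] := gap_atP (le_trans x_ge le_xy); exact: le_trans le_x le_xy.
Qed.

(** A minimum is at most [x] iff one of its terms is; the bound on [x] excludes the default
    [xright I + 1]. *)
Lemma left_endP (c q : nat) x : x <= xright I ->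
  reflect (exists p : nat, [/\ (p < q)%N, colat I p = c & xat I p <= x])
          (left_end I c q <= x).
Proof.
move=> x_le; elim: q => [|q IHq] /=.
  apply: (iffP idP) => [|[p []] //].
  by rewrite leNgt (le_lt_trans x_le) // ltrDl ltr01.
have keep : (exists p : nat, [/\ (p < q)%N, colat I p = c & xat I p <= x]) ->
    exists p : nat, [/\ (p < q.+1)%N, colat I p = c & xat I p <= x].
  by case=> p [lt_pq cp xp]; exists p; split=> //; apply: leqW.
case: ifP => [/andP[/eqP cq lt_q] | skip_q].
  apply: (iffP idP) => [xq | [p [le_pq cp xp]]]; first by exists q.
  move: le_pq; rewrite ltnS leq_eqVlt => /orP[/eqP <- // | lt_pq].
  by apply: le_trans (ltW lt_q) _; apply/IHq; exists p.
apply: (iffP IHq) => [/keep // | [p [le_pq cp xp]]].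
move: le_pq; rewrite ltnS leq_eqVlt => /orP[/eqP eq_pq | lt_pq]; last by exists p.
move: skip_q; rewrite -eq_pq cp eqxx /= => /negbT; rewrite -leNgt => le_p.
by rewrite -eq_pq in IHq *; apply/IHq; apply: le_trans le_p xp.
Qed.

Lemma underE i p :
  under I i p = [exists q, leftmost i q && (px q <= px p <= xright I)].
Proof.
have /andP[_ p_le] := px_in_rect p.
have xatE q : xat I q = px q := ext_ord _ _ q.
have colatE q : colat I q = color q := ext_ord _ _ q.
rewrite /under xatE; apply/(left_endP _ _ p_le)/existsP.
  case=> q [lt_qn]; rewrite -[q]/(val (Ordinal lt_qn)) colatE xatE.
  move: (Ordinal lt_qn) => {lt_qn}q cq le_qp.
  have cqi : color q == i by apply/eqP/val_inj.
  case: (@arg_minP _ _ _ q (fun q => color q == i) (@px F I) cqi) => r cr min_r.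
  exists r; rewrite /leftmost cr p_le (le_trans (min_r q cqi)) // !andbT /=.
  by apply/forallP => s; apply/implyP/min_r.
case=> q /andP[/andP[/eqP cq _] /andP[le_qp _]].
by exists q; rewrite ltn_ord colatE xatE cq.
Qed.

(** * Crossings of backbones in the given order *)

Section Crossings.
Variable b : 'I_k -> F.
Hypothesis b_decr : forall i j, (i < j)%N -> b j < b i.

(** The order of the labels settles one end of the vertical segment: the backbone of [color p] is
    above [b i] if [color p < i] and below it if [i < color p]. Only the comparison with the point
    itself remains. *)
Lemma crossesE i p :
  crosses b i p = under I i p &&
    (if (color p < i)%N then py p <= b i else (i < color p)%N && (b i <= py p)).
Proof.
rewrite /crosses !inE /= !eqxx /= -underE -val_eqE /=.
case: ltngtP => [lt_ci | lt_ic | _] /=; last by rewrite andbF.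
  congr (_ && _); rewrite ge_min le_max (ltW (b_decr lt_ci)) orbT andbT.
  by rewrite (leNgt (b _)) b_decr // orbF.
congr (_ && _); rewrite ge_min le_max (ltW (b_decr lt_ic)) orbT /=.
by rewrite (leNgt (b i) (b _)) b_decr // orbF.
Qed.

Lemma crossingsE : crossings b = (\sum_(i < k) \sum_(p < n) crosses b i p)%N.
Proof.
rewrite /crossings cardsE -sum1_card big_mkcond pair_big /=.
apply: eq_bigr => -[i p] _.
by rewrite -[X in if X then _ else _]/(crosses b i p); case: crosses.
Qed.

(** Only an inequality holds: a point at the height of the backbone may be crossed without being
    counted in the adjacent gap. *)
Lemma gap_cost_le_crosses i g :
    (forall p, (p < g)%N -> b i <= py p) ->
    (forall p, (g <= p)%N -> py p <= b i) ->
  (gap_cost I i g <= \sum_(p < n) crosses b i p)%N.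
Proof.
move=> above below; apply: leq_sum => p _; rewrite crossesE.
have -> : colat I p = color p := ext_ord _ _ p.
case: under => //=; case: (ltnP p g) => [/above le_b | /below le_p].
  by case: ltngtP => //=; rewrite le_b.
by case: ltngtP => //=; rewrite le_p.
Qed.

Lemma gap_cost_eq_crosses i g :
    (forall p, (p < g)%N -> b i < py p) ->
    (forall p, (g <= p)%N -> py p < b i) ->
  (\sum_(p < n) crosses b i p = gap_cost I i g)%N.
Proof.
move=> above below; apply: eq_bigr => p _; rewrite crossesE.
have -> : colat I p = color p := ext_ord _ _ p.
case: under => //=; case: (ltnP p g) => [/above lt_b | /below lt_p].
  by case: ltngtP; rewrite //= ?(ltW lt_b) // leNgt lt_b.
by case: ltngtP; rewrite //= ?(ltW lt_p) // leNgt lt_p.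
Qed.

(** Backbones have distinct heights, vertical segments of distinct points have distinct abscissas,
    and a horizontal and a vertical segment share at most one point. *)
Lemma decr_no_overlap i j : i != j -> ~ overlap b i j.
Proof.
move=> ne_ij [s [t [z [z' [si tj ne_z]]]]].
case: si => [-> | [p cp ->]]; case: tj => [-> | [q cq ->]];
  rewrite !inE => /andP[/andP[/eqP z1 _] /andP[/eqP z1' _]]
    /andP[/andP[/eqP z2 _] /andP[/eqP z2' _]].
- have eq_b : b i = b j by rewrite -z1 -z2.
  by move: ne_ij; rewrite -val_eqE; case: ltngtP => // /b_decr; rewrite eq_b ltxx.
- by case/eqP: ne_z; apply/eqP; rewrite -pair_eqE /= z2 z2' z1 z1' !eqxx.
- by case/eqP: ne_z; apply/eqP; rewrite -pair_eqE /= z2 z2' z1 z1' !eqxx.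
by case/eqP: ne_ij; rewrite -cp -cq; congr color; apply: px_inj; rewrite -z1 -z2.
Qed.

End Crossings.

(** * Optimality of the computed heights *)

Local Notation optimum := (best (big_cost I) (cost I) k n).

Lemma optimumE : optimum = (\sum_(i < k) cost I i (gap_of I i))%N.
Proof. by rewrite best_trace //; move=> *; apply: cost_le. Qed.

(** Moving each backbone to [gap_at] of its height gives a monotone choice of proper gaps that costs
    no more than the crossings of [b]. *)
Lemma optimum_le (b : 'I_k -> F) : labeling b -> (optimum <= crossings b)%N.
Proof.
case=> b_rect b_decr _.
have b_ge i : ybot I <= b i by case/andP: (b_rect i).
pose h := ext 0%N (fun i => gap_at (b i)).
have hE i : h i = gap_at (b i) := ext_ord _ _ i.
apply: (@leq_trans (\sum_(i < k) cost I i (h i))%N).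
  apply: best_opt => [i g|j j' le_jj' lt_j'k|j lt_jk]; first exact: cost_le.
    have lt_jk := leq_ltn_trans le_jj' lt_j'k.
    rewrite (hE (Ordinal lt_jk)) (hE (Ordinal lt_j'k)) gap_at_anti //.
    move: le_jj'; rewrite leq_eqVlt => /orP[/eqP eq_jj' | lt_jj'].
      by rewrite le_eqVlt (_ : Ordinal _ = Ordinal lt_j'k) ?eqxx //; apply: val_inj.
    exact/ltW/b_decr.
  by rewrite (hE (Ordinal lt_jk)); case: (gap_atP (b_ge (Ordinal lt_jk))).
rewrite (crossingsE b); apply: leq_sum => i _; rewrite hE.
have [_ ok_g le_b _] := gap_atP (b_ge i).
rewrite /cost -/(proper_gap _) ok_g; apply: gap_cost_le_crosses => // p.
  move=> lt_pg; rewrite -gap_endS (le_trans _ (gap_end_anti lt_pg)) //.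
  by case/andP: (b_rect i); apply: gap_at_ge.
by move=> le_gp; rewrite -gap_endS (le_trans _ le_b) // gap_end_anti.
Qed.

(** Putting all colors into the highest proper gap costs at most [n * k], while a single improper
    gap already costs more. *)
Lemma gap_of_proper i : proper_gap (gap_of I i).
Proof.
have [g_le ok_g _ _] := gap_atP (ltW (rect_height I)).
have : (optimum <= n * k)%N.
  apply: leq_trans (best_opt (h := fun=> gap_at (ytop I)) _ _ _) _ => //.
    by move=> *; apply: cost_le.
  rewrite -[X in (_ <= _ * X)%N]card_ord mulnC -sum_nat_const; apply: leq_sum.
  by move=> j _; rewrite /cost -/(proper_gap _) ok_g gap_cost_le.
rewrite optimumE (bigD1 i) //= leqNgt; apply: contraR => improper.
by rewrite /cost -/(proper_gap _) (negbTE improper) /big_cost addSn ltnS leq_addr.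
Qed.

Lemma gap_of_mono i j : (i <= j)%N -> (gap_of I i <= gap_of I j)%N.
Proof.
by move=> le_ij; apply: trace_mono => // *; apply: cost_le.
Qed.

Lemma height_in_gap i :
  gap_end (gap_of I i).+1 < height I i < gap_end (gap_of I i).
Proof.
have := gap_of_proper i; rewrite /height /proper_gap -mulrA.
set x := gap_end _.+1; set y := gap_end _ => lt_xy.
have t_gt0 : 0 < (k - i)%:R / k.+1%:R :> F.
  by rewrite divr_gt0 ?ltr0n ?subn_gt0.
have t_lt1 : (k - i)%:R / k.+1%:R < 1 :> F.
  by rewrite ltr_pdivrMr ?ltr0n // mul1r ltr_nat ltnS leq_subr.
by set t := _ / _ in t_gt0 t_lt1 *; nra.
Qed.

(** Within one gap the factor in [height] decides; two different gaps are separated by a gap end. *)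
Lemma height_decr i j : (i < j)%N -> height I j < height I i.
Proof.
move=> lt_ij; have /andP[gt_i _] := height_in_gap i.
have /andP[_ lt_j] := height_in_gap j.
have := gap_of_mono (ltnW lt_ij); rewrite leq_eqVlt => /orP[/eqP eq_g | lt_g].
  have := gap_of_proper i; rewrite /proper_gap -subr_gt0 => gap_gt0.
  rewrite /height -eq_g ltrD2l ltr_pM2r ?invr_gt0 ?ltr0n //.
  by rewrite (ltr_pM2l gap_gt0) ltr_nat ltn_sub2l.
by apply: lt_trans lt_j (le_lt_trans (gap_end_anti lt_g) gt_i).
Qed.

(** The heights are interior to their gaps, so the number of crossings is at most [optimum], the
    lower bound for every labeling. Pointwise equality is what is known of the output array. *)
Lemma height_optimal (b : 'I_k -> F) :
  (forall i, b i = height I i) -> min_crossing_labeling b.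
Proof.
move=> bE.
have b_decr i j : (i < j)%N -> b j < b i by rewrite !bE; apply: height_decr.
split.
  split=> // [i|i j]; last exact: decr_no_overlap.
  have /andP[gt_b lt_b] := height_in_gap i; rewrite bE.
  rewrite (le_trans (gap_end_ge _) (ltW gt_b)) /=.
  exact: le_trans (ltW lt_b) (gap_end_anti (leq0n _)).
move=> b' /optimum_le; rewrite (crossingsE b) optimumE; apply: leq_trans.
apply: leq_sum => i _; have /andP[gt_b lt_b] := height_in_gap i.
rewrite /cost -/(proper_gap _) gap_of_proper.
rewrite (gap_cost_eq_crosses b_decr (g := gap_of I i)) // => p; rewrite bE.
  by move=> lt_pg; rewrite -gap_endS (lt_le_trans lt_b) // gap_end_anti.
by move=> le_gp; rewrite -gap_endS (le_lt_trans _ gt_b) // gap_end_anti.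
Qed.

End Gaps.

Lemma input_inputs (F : realFieldType) (I : instance F) : inputs I (input I).
Proof. by split. Qed.

Lemma input_fresh (F : realFieldType) (I : instance F) : fresh (input I).
Proof. by split. Qed.

Theorem theorem6 :
  exists (A : prog) (K : nat),
    forall (F : realFieldType) (I : instance F),
      (0 < npts I)%N ->
      exists (m : store F) (T : nat),
        exec A (input I) m T /\
        (T <= K * (npts I * ncol I))%N /\
        min_crossing_labeling (output I m).
Proof.
exists backbone_prog, 150%N => F I n_gt0.
have [m [T [eA le_T outE]]] :=
  backbone_prog_runs n_gt0 (input_inputs I) (input_fresh I) erefl erefl.
exists m, T; split=> //; split=> //; apply: height_optimal => // i.
by rewrite /output outE.
Qed.
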